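(* Let $R$ be a ring and $n>1$ an integer. The diagonal extension $R\subseteq R^n$ has FIP if and only if $R$ is an FMIR and, in case $R$ is a $\Sigma$FMIR, $n=2$.
   Context: All rings are commutative, unital and nonzero. For a ring extension $R\subseteq S$, $[R,S]$ is the set of all $R$-subalgebras of $S$; the extension has FIP if $[R,S]$ is finite. A special principal ideal ring (SPIR) is a principal ideal ring $R$ with a unique prime ideal $M=Rt$, where $M$ is nonzero and nilpotent (so a SPIR is not a field). An FMIR is a ring with only finitely many ideals. A $\Sigma$FMIR is an FMIR $R$ such that $R_M$ is an infinite SPIR for at least one maximal ideal $M$ of $R$. *)

(* Defs.v *)
From HB Require Import structures.
From mathcomp Require Import all_boot all_order all_algebra.
From mathcomp Require Import generic_quotient ring.
From mathcomp Require Import boolp classical_sets functions cardinality.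

Set Implicit Arguments.
Unset Strict Implicit.
Unset Printing Implicit Defensive.

Import GRing.Theory.
Local Open Scope classical_set_scope.
Local Open Scope quotient_scope.
Local Open Scope ring_scope.

Section Ideals.
Variable R : comNzRingType.
Implicit Types (I J M P : set R) (t : R).

(* Unlike [idealr_closed], the unit ideal is included. *)
Definition ideal I : Prop :=
  [/\ I 0, forall x y, I x -> I y -> I (x + y) & forall r x, I x -> I (r * x)].

Definition prime_ideal P : Prop :=
  [/\ ideal P, P <> setT & forall x y, P (x * y) -> P x \/ P y].

Definition maximal_ideal M : Prop :=
  [/\ ideal M, M <> setT &
      forall I, ideal I -> M `<=` I -> I = M \/ I = setT].

Definition principal t : set R := [set r * t | r in setT].

Definition ideal_mul I J : set R :=
  smallest ideal [set z | exists x y, [/\ I x, J y & z = x * y]].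

Definition ideal_exp I (k : nat) : set R := iter k (ideal_mul I) setT.

Definition nilpotent_ideal I : Prop := exists k, ideal_exp I k = [set 0].

Definition principal_ideal_ring : Prop :=
  forall I, ideal I -> exists t, I = principal t.

Definition SPIR : Prop :=
  principal_ideal_ring /\
  exists t, [/\ prime_ideal (principal t),
                forall P, prime_ideal P -> P = principal t,
                principal t <> [set 0] &
                nilpotent_ideal (principal t)].

Definition FMIR : Prop := finite_set [set I : set R | ideal I].

Lemma maximal_prime M : maximal_ideal M -> prime_ideal M.
Proof.
case=> -[M0 MD MM] MT Mmax; split=> // x y Mxy.
have [Mx|nMx] := pselect (M x); [by left|right].
pose I : set R := [set z | exists r m, M m /\ z = r * x + m].
have idI : ideal I.
  split=> [|_ _ [r [m [Mm ->]]] [r' [m' [Mm' ->]]]|s _ [r [m [Mm ->]]]].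
  - by exists 0, 0; rewrite mul0r addr0.
  - by exists (r + r'), (m + m'); split; [exact: MD|rewrite mulrDl addrACA].
  - by exists (s * r), (s * m); split; [exact: MM|rewrite mulrDr mulrA].
have MI : M `<=` I by move=> m Mm; exists 0, m; rewrite mul0r add0r.
have [IM|IT] := Mmax I idI MI.
  by case: nMx; rewrite -IM; exists 1, 0; rewrite mul1r addr0.
have [r [m [Mm e1]]] : I 1 by rewrite IT.
rewrite -[y]mul1r e1 mulrDl -mulrA; apply: MD; first exact: MM.
by rewrite mulrC; apply: MM.
Qed.

End Ideals.

Module Localization.
Section Localization.
Variables (R : comNzRingType) (P : set R) (hP : prime_ideal P).

Definition den : Type := {s : R | s \notin P}.
HB.instance Definition _ := Choice.copy den {s : R | s \notin P}.

Definition denv (s : den) : R := sval s.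

Lemma denP (s : den) : ~ P (denv s).
Proof. by case: s => s /= /negP; rewrite in_setE. Qed.

Lemma den1_subproof : (1 : R) \notin P.
Proof.
have [[_ _ PM] PT _] := hP.
apply/negP; rewrite in_setE => P1; apply: PT; apply/seteqP; split=> // x _.
by rewrite -[x]mulr1; apply: PM.
Qed.

Lemma denM_subproof (s t : den) : denv s * denv t \notin P.
Proof.
have [_ _ Pp] := hP.
by apply/negP; rewrite in_setE => /Pp[]; apply: denP.
Qed.

Definition den1 : den := exist _ 1 den1_subproof.
Definition denM (s t : den) : den :=
  exist _ (denv s * denv t) (denM_subproof s t).

(* The factor [u] is needed because [R] may have zero divisors. *)
Definition equiv (x y : R * den) : bool :=
  `[< exists u : den,
        denv u * (x.1 * denv y.2) = denv u * (y.1 * denv x.2) >].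

Lemma equiv_refl : reflexive equiv.
Proof. by move=> x; apply/asboolP; exists den1. Qed.

Lemma equiv_sym : symmetric equiv.
Proof. by move=> x y; apply/asboolP/asboolP=> -[u e]; exists u. Qed.

Lemma equiv_trans : transitive equiv.
Proof.
move=> [y t] [x s] [z v] /asboolP[/= u e] /asboolP[/= u' e'].
apply/asboolP; exists (denM (denM u u') t) => /=; rewrite /denM /=.
transitivity (denv u' * denv v * (denv u * (x * denv t))).
  by rewrite /denv /=; ring.
rewrite e; transitivity (denv u * denv s * (denv u' * (y * denv v))).
  by rewrite /denv /=; ring.
by rewrite e' /denv /=; ring.
Qed.

Canonical equiv_equiv := EquivRel equiv equiv_refl equiv_sym equiv_trans.

Definition type := {eq_quot equiv}.
HB.instance Definition _ : EqQuotient _ equiv type := EqQuotient.on type.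
HB.instance Definition _ := Choice.on type.

(* [mk a s] is the fraction a / s. *)
Definition mk (a : R) (s : den) : type := \pi_type (a, s).

Lemma mk_eqP (a b : R) (s t : den) :
  mk a s = mk b t <->
  exists u : den, denv u * (a * denv t) = denv u * (b * denv s).
Proof.
by split=> [/eqmodP/asboolP//|h]; apply/eqmodP; apply/asboolP.
Qed.

Lemma mk_surj (x : type) : exists a s, x = mk a s.
Proof. by elim/quotW: x => -[a s]; exists a, s. Qed.

Definition add (x y : type) : type :=
  let: (a, s) := repr x in let: (b, t) := repr y in
  mk (a * denv t + b * denv s) (denM s t).

Definition mul (x y : type) : type :=
  let: (a, s) := repr x in let: (b, t) := repr y in
  mk (a * b) (denM s t).

Definition opp (x : type) : type :=
  let: (a, s) := repr x in mk (- a) s.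

Definition zero : type := mk 0 den1.
Definition one : type := mk 1 den1.

Lemma mk_repr a s a' s' : repr (mk a s) = (a', s') -> mk a s = mk a' s'.
Proof. by move=> e; rewrite -[LHS]reprK e. Qed.

Lemma addE a b s t :
  add (mk a s) (mk b t) = mk (a * denv t + b * denv s) (denM s t).
Proof.
rewrite /add; case ex: (repr (mk a s)) => [a' s']; case ey: (repr _) => [b' t'].
have /mk_eqP[u e] := mk_repr ex; have /mk_eqP[v f] := mk_repr ey.
apply/mk_eqP; exists (denM u v); rewrite /denv /= -!/(denv _).
transitivity (denv v * denv t * denv t' * (denv u * (a' * denv s)) +
              denv u * denv s * denv s' * (denv v * (b' * denv t))).
  by ring.
by rewrite -e -f; ring.
Qed.

Lemma mulE a b s t : mul (mk a s) (mk b t) = mk (a * b) (denM s t).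
Proof.
rewrite /mul; case ex: (repr (mk a s)) => [a' s']; case ey: (repr _) => [b' t'].
have /mk_eqP[u e] := mk_repr ex; have /mk_eqP[v f] := mk_repr ey.
apply/mk_eqP; exists (denM u v); rewrite /denv /= -!/(denv _).
transitivity (denv u * (a' * denv s) * (denv v * (b' * denv t))); first by ring.
by rewrite -e -f; ring.
Qed.

Lemma oppE a s : opp (mk a s) = mk (- a) s.
Proof.
rewrite /opp; case ex: (repr (mk a s)) => [a' s'].
have /mk_eqP[u e] := mk_repr ex.
by apply/mk_eqP; exists u; rewrite !mulNr !mulrN e.
Qed.

Lemma addA : associative add.
Proof.
move=> x y z; have [a [s ->]] := mk_surj x.
have [b [t ->]] := mk_surj y; have [c [v ->]] := mk_surj z.
by rewrite !addE; apply/mk_eqP; exists den1; rewrite /denv /= -!/(denv _); ring.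
Qed.

Lemma addC : commutative add.
Proof.
move=> x y; have [a [s ->]] := mk_surj x; have [b [t ->]] := mk_surj y.
by rewrite !addE; apply/mk_eqP; exists den1; rewrite /denv /= -!/(denv _); ring.
Qed.

Lemma add0 : left_id zero add.
Proof.
move=> x; have [a [s ->]] := mk_surj x.
by rewrite !addE; apply/mk_eqP; exists den1; rewrite /denv /= -!/(denv _); ring.
Qed.

Lemma addN : left_inverse zero opp add.
Proof.
move=> x; have [a [s ->]] := mk_surj x.
rewrite oppE !addE; apply/mk_eqP; exists den1.
by rewrite /denv /= -!/(denv _); ring.
Qed.

HB.instance Definition _ := GRing.isZmodule.Build type addA addC add0 addN.

Lemma mulA : associative mul.
Proof.
move=> x y z; have [a [s ->]] := mk_surj x.
have [b [t ->]] := mk_surj y; have [c [v ->]] := mk_surj z.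
by rewrite !mulE; apply/mk_eqP; exists den1; rewrite /denv /= -!/(denv _); ring.
Qed.

Lemma mulC : commutative mul.
Proof.
move=> x y; have [a [s ->]] := mk_surj x; have [b [t ->]] := mk_surj y.
by rewrite !mulE; apply/mk_eqP; exists den1; rewrite /denv /= -!/(denv _); ring.
Qed.

Lemma mul1 : left_id one mul.
Proof.
move=> x; have [a [s ->]] := mk_surj x.
by rewrite !mulE; apply/mk_eqP; exists den1; rewrite /denv /= -!/(denv _); ring.
Qed.

Lemma mulDl : left_distributive mul add.
Proof.
move=> x y z; have [a [s ->]] := mk_surj x.
have [b [t ->]] := mk_surj y; have [c [v ->]] := mk_surj z.
rewrite !(mulE, addE); apply/mk_eqP; exists den1.
by rewrite /denv /= -!/(denv _); ring.
Qed.

Lemma one_neq0 : one != zero.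
Proof.
have [[P0 _ _] _ _] := hP.
apply/eqP => /mk_eqP[u]; rewrite /denv /= mul0r !mulr1 mulr0 => u0.
by apply: (@denP u); rewrite /denv u0.
Qed.

HB.instance Definition _ :=
  GRing.Zmodule_isComNzRing.Build type mulA mulC mul1 mulDl one_neq0.

End Localization.
End Localization.
HB.export Localization.

Definition localization (R : comNzRingType) (P : set R) (hP : prime_ideal P) :
  comNzRingType := Localization.type hP.

Definition SigmaFMIR (R : comNzRingType) : Prop :=
  FMIR R /\
  exists (M : set R) (hM : maximal_ideal M),
    SPIR (localization (maximal_prime hM)) /\
    infinite_set [set: localization (maximal_prime hM)].

Fact ffun_mulC (I : finType) (R : comPzRingType) :
  commutative (@GRing.mul {ffun I -> R}).
Proof. by move=> g h; apply/ffunP=> i; rewrite !ffunE mulrC. Qed.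

HB.instance Definition _ (I : finType) (R : comPzRingType) :=
  GRing.PzRing_hasCommutativeMul.Build {ffun I -> R} (@ffun_mulC I R).

Section Extensions.
Variables (R S : comPzRingType) (f : {rmorphism R -> S}).

(* An extension R <= S is represented by its inclusion morphism [f]; see
   [diagonal_inj] below for the injectivity of the diagonal one. *)
Definition subalgebra (A : set S) : Prop :=
  GRing.subring_closed (mem A) /\ forall r x, A x -> A (f r * x).

Definition FIP : Prop := finite_set [set A : set S | subalgebra A].

End Extensions.

Section Diagonal.
Variables (R : comNzRingType) (n : nat).

Definition diagonal (r : R) : {ffun 'I_n -> R} := [ffun=> r].

Lemma diagonal_is_zmod_morphism : zmod_morphism diagonal.
Proof. by move=> x y; apply/ffunP=> i; rewrite !ffunE. Qed.

Lemma diagonal_is_monoid_morphism : monoid_morphism diagonal.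
Proof. by split=> [|x y]; apply/ffunP=> i; rewrite !ffunE. Qed.

HB.instance Definition _ :=
  GRing.isZmodMorphism.Build R {ffun 'I_n -> R} diagonal
    diagonal_is_zmod_morphism.
HB.instance Definition _ :=
  GRing.isMonoidMorphism.Build R {ffun 'I_n -> R} diagonal
    diagonal_is_monoid_morphism.

Lemma diagonal_inj : (0 < n)%N -> injective diagonal.
Proof. by move=> n0 x y /ffunP/(_ (Ordinal n0)); rewrite !ffunE. Qed.

End Diagonal.

(* Main.v *)
From HB Require Import structures.
From mathcomp Require Import all_boot all_algebra.
From mathcomp Require Import ring finmap.
From mathcomp Require Import boolp classical_sets cardinality.
Require Import Defs.

(** Why the theorem holds.

    Write D for the diagonal copy of R in R^n.  For an ideal I, the tuples x
    with x_1 - x_0 in I form a subalgebra that determines I, so FIP forces R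
    to have finitely many ideals ([FIP_FMIR]); for n = 2 every subalgebra A
    is D + (I x 0) with I = {a | (a, 0) in A}, which gives the converse
    ([FIP_square]).

    For n > 2, suppose that L = R_M is a SPIR with maximal ideal (t), and let
    s be the last nonzero power of t; then s ^ 2 = 0 and the annihilator of s
    is (t).  Since R has finitely many ideals, R -> L is onto, and the tuples
    whose first three coordinates are, in L, of the form (r, r + c s,
    r + c l s) form a subalgebra A_l of R^n which determines l modulo (t).  So
    FIP makes L / (t) finite, and then L is finite because t is nilpotent
    ([FIP_finite_SPIR]).

    Conversely, let R have finitely many ideals, with no localization at a
    maximal ideal an infinite SPIR, and let J be the Jacobson radical.
    - J is finite ([finite_jacobson]).  Otherwise, take I a maximal finite
      ideal inside J and K minimal above I inside J.  Then K / I is isomorphic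
      to R / M for a maximal ideal M, and it is infinite because K is.  In
      L = R_M the ideals (x + l y), for l in the infinite residue field,
      cannot all be distinct, so principal ideals are comparable
      ([principal_chain]) and L is a principal ideal ring.  An element of K
      outside I survives in L, so L is not a field: it is an infinite SPIR.
    - R / J is von Neumann regular with finitely many idempotents.  Over a
      finite product of fields, Lagrange interpolation writes every element of
      a subalgebra of R^n as a combination of tuples of idempotents lying in
      it.  This can be done modulo J without splitting R into factors
      ([interpolation]), so a subalgebra is determined by its tuples with
      entries in the finite set T of elements that are idempotent modulo J
      ([subalgebra_idem_mod], [finite_idem_mod]), and there are finitely many
      sets of such tuples. *)

Set Implicit Arguments.
Unset Strict Implicit.
Unset Printing Implicit Defensive.

Import GRing.Theory.

(** * Finite sets *)

Section FiniteSets.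
Local Open Scope classical_set_scope.

Lemma finite_fibers (T U : Type) (g : T -> U) (A : set T) :
  finite_set (g @` A) -> (forall y, finite_set (A `&` g @^-1` [set y])) ->
  finite_set A.
Proof.
move=> finI finF; apply: (@sub_finite_set _ _
    (\bigcup_(y in g @` A) (A `&` g @^-1` [set y]))).
  by move=> x Ax; exists (g x); [exists x|split].
by apply: bigcup_finite.
Qed.

Lemma finite_inj_on (T U : Type) (g : T -> U) (A : set T) :
  finite_set (g @` A) -> (forall x y, A x -> A y -> g x = g y -> x = y) ->
  finite_set A.
Proof.
move=> finI inj; apply: finite_fibers finI _ => u.
have [[x [Ax gx]]|none] := pselect (exists x, A x /\ g x = u).
  apply: (sub_finite_set _ (finite_set1 x)) => y [Ay gy].
  by apply: inj => //; rewrite gx; exact: gy.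
rewrite (_ : _ `&` _ = set0); first exact: finite_set0.
by apply/seteqP; split=> // y [Ay gy]; apply: none; exists y.
Qed.

(** Finitely many values are already taken on a finite set of arguments.  This
    is how counting ideals or subalgebras is turned into a bound on residue
    fields. *)
Lemma finite_range_reps (T : choiceType) (U : Type) (g : T -> U) :
  finite_set (range g) ->
  exists2 F : set T, finite_set F & forall x, exists2 y, F y & g y = g x.
Proof.
move=> fin; have [[x0]|none] := pselect (inhabited T); last first.
  by exists set0; [exact: finite_set0|move=> x; case: none; exists].
pose h u := xget x0 [set x | g x = u].
exists (h @` range g); first exact: finite_image.
move=> x; exists (h (g x)); first by exists (g x) => //; exists x.
by have := @xgetPex _ x0 [set y | g y = g x] (ex_intro _ x erefl).
Qed.

(** A member with the fewest members above it is maximal: passing to a strictly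
    larger member loses at least the smaller one. *)
Lemma finite_maximal (T : Type) (C : set (set T)) (X0 : set T) :
  finite_set C -> C X0 ->
  exists2 X, C X & forall Y, C Y -> X `<=` Y -> Y = X.
Proof.
move=> finC CX0; pose up X := [set Y | C Y /\ X `<=` Y].
have finU X : finite_set (up X) by apply: sub_finite_set finC => Y [].
pose P k := `[< exists2 X, C X & (#|` fset_set (up X)|)%fset = k >].
have exP : exists k, P k.
  by exists (#|` fset_set (up X0)|)%fset; apply/asboolP; exists X0.
have [k /asboolP[X CX cX] kmin] := ex_minnP exP.
exists X => // Y CY XY; apply: contrapT => neq.
have /kmin : P (#|` fset_set (up Y)|)%fset by apply/asboolP; exists Y.
rewrite -cX leqNgt => /negP; apply; apply: fproper_ltn_card.
rewrite fproperE; apply/andP; split.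
  apply/fsubsetP=> Z; rewrite !in_fset_set // !in_setE => -[CZ YZ]; split=> //.
  exact: subset_trans YZ.
apply/negP => /fsubsetP/(_ X); rewrite !in_fset_set // !in_setE => XY'.
apply: neq; have [_ YX] := XY' (conj CX (@subset_refl _ X)).
by apply/seteqP; split.
Qed.

Lemma finite_minimal (T : Type) (C : set (set T)) (X0 : set T) :
  finite_set C -> C X0 ->
  exists2 X, C X & forall Y, C Y -> Y `<=` X -> Y = X.
Proof.
move=> finC CX0.
have CX0' : [set ~` X | X in C] (~` X0) by exists X0.
have [_ [X CX <-] Xmax] := finite_maximal (finite_image (@setC T) finC) CX0'.
exists X => // Y CY YX; apply: (inv_inj (@setCK T)).
by apply: Xmax; [exists Y|exact: subsetC].
Qed.

Lemma finite_subsets (T : choiceType) (X : set T) :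
  finite_set X -> finite_set [set Y | Y `<=` X].
Proof.
move=> finX; apply: (@finite_inj_on _ _ (@fset_set T)); last first.
  move=> Y Z YX ZX e.
  by rewrite -(fset_setK (sub_finite_set YX finX)) e fset_setK //;
    exact: sub_finite_set finX.
apply: (@finite_subfset _ (fpowerset (fset_set X))) => _ [Y YX <-].
rewrite /= fpowersetE -fset_set_sub //; exact: sub_finite_set finX.
Qed.

Lemma finite_ffun_on (I : finType) (T : choiceType) (X : set T) :
  finite_set X -> finite_set [set x : {ffun I -> T} | forall i, X (x i)].
Proof.
move=> /finite_fsetP[F ->].
pose h (g : {ffun I -> F}) : {ffun I -> T} := [ffun i => val (g i)].
apply: (@sub_finite_set _ _ (range h)) => [x /= Fx|]; last exact: finite_image.
by exists [ffun i => FSetSub (Fx i)] => //; apply/ffunP=> i; rewrite !ffunE.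
Qed.

End FiniteSets.

(** * Ideals and quasi-inverses *)

Section Rings.
Local Open Scope classical_set_scope.
Local Open Scope ring_scope.
Variable R : comNzRingType.
Implicit Types (I J M : set R) (x y t : R).

Lemma ideal_principal t : ideal (principal t).
Proof.
split=> [|_ _ [r _ <-] [s _ <-]|r _ [s _ <-]].
- by exists 0; rewrite ?mul0r.
- by exists (r + s); rewrite ?mulrDl.
- by exists (r * s); rewrite ?mulrA.
Qed.

Lemma principal_gen t : principal t t.
Proof. by exists 1; rewrite ?mul1r. Qed.

Lemma principal_sub I t : ideal I -> I t -> principal t `<=` I.
Proof. by case=> _ _ IM It _ [r _ <-]; apply: IM. Qed.

Lemma idealN I x : ideal I -> I x -> I (- x).
Proof. by case=> _ _ IM Ix; rewrite -mulN1r; apply: IM. Qed.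

Lemma idealB I x y : ideal I -> I x -> I y -> I (x - y).
Proof.
move=> idI Ix Iy; case: (idI) => _ ID _; apply: ID => //; exact: idealN.
Qed.

Lemma ideal_1 I : ideal I -> I 1 -> I = setT.
Proof.
case=> _ _ IM I1; apply/seteqP; split=> // x _.
by rewrite -[x]mulr1; apply: IM.
Qed.

(** The principal ideals generated by the powers of x cannot all differ. *)
Lemma FMIR_power_stable x : FMIR R -> exists k c, x ^+ k = c * x ^+ k.+1.
Proof.
move=> fin; apply: contrapT => none; apply: infinite_nat.
apply: (@finite_inj_on _ _ (fun k => principal (x ^+ k))).
  by apply: sub_finite_set fin => _ [k _ <-]; apply: ideal_principal.
suff H k l : (k < l)%N -> principal (x ^+ k) <> principal (x ^+ l).
  by move=> k l _ _; case: (ltngtP k l) => // /H // + e; rewrite e.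
move=> lt_kl e; apply: none; have := principal_gen (x ^+ k).
rewrite e => -[r _ er]; exists k, (r * x ^+ (l - k.+1)).
by rewrite -mulrA -exprD subnK // er.
Qed.

End Rings.

Section Jacobson.
Local Open Scope classical_set_scope.
Local Open Scope ring_scope.
Variable R : comNzRingType.

Definition jacobson : set R := [set x | forall M, maximal_ideal M -> M x].

Lemma jacobson_ideal : ideal jacobson.
Proof.
split=> [M [[]]//|x y Jx Jy M hM|r x Jx M hM].
  by case: (hM) => -[_ MD _] _ _; apply: MD; [apply: Jx|apply: Jy].
by case: (hM) => -[_ _ MM] _ _; apply: MM; apply: Jx.
Qed.

(** The quotient by the Jacobson radical is von Neumann regular: x ^ k (1 - c x)
    vanishes for some k and c, so every prime ideal contains x or 1 - c x. *)
Lemma FMIR_quasi_inverse x : FMIR R -> exists y, jacobson (x * (1 - x * y)).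
Proof.
move=> /(FMIR_power_stable x)[k [c e]]; exists c => M hM.
have [[M0 MD MM] _ Mp] := maximal_prime hM.
have : M (x ^+ k * (1 - x * c)).
  by rewrite mulrBr mulr1 {1}e exprS (_ : _ - _ = 0) //; ring.
elim: k {e} => [|k IHk]; first by rewrite expr0 mul1r; apply: MM.
rewrite exprS -mulrA => /Mp[Mx|//].
by rewrite mulrC; apply: MM.
Qed.

End Jacobson.

(** * Interpolation in subalgebras of a power *)

Section Subalgebras.
Local Open Scope classical_set_scope.
Local Open Scope ring_scope.
Variables (R S : comPzRingType) (f : {rmorphism R -> S}) (A : set S).

Lemma subalgebraP :
  subalgebra f A <->
  [/\ A 1, forall x y, A x -> A y -> A (x - y),
      forall x y, A x -> A y -> A (x * y) & forall r x, A x -> A (f r * x)].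
Proof.
split=> [[[]]|[]].
  rewrite in_setE => A1 AB AM AZ; split=> // x y Ax Ay; rewrite -in_setE.
    by apply: AB; rewrite in_setE.
  by apply: AM; rewrite in_setE.
move=> A1 AB AM AZ; split=> //.
by split; rewrite ?in_setE // => x y; rewrite !in_setE; [apply: AB|apply: AM].
Qed.

Lemma subalgebraD x y :
  subalgebra f A -> A x -> A y -> A (x + y).
Proof.
move=> /subalgebraP[A1 AB AM AZ] Ax Ay; rewrite -[y]opprK -[- y]sub0r.
by apply: (AB) => //; apply: (AB) => //; rewrite -(subrr 1); apply: AB.
Qed.

End Subalgebras.

Section Interpolation.
Local Open Scope classical_set_scope.
Local Open Scope ring_scope.
Variables (R : comNzRingType) (n : nat).
Implicit Types A B : set {ffun 'I_n -> R}.

Lemma prod_ffunE (I : Type) (s : seq I) (P : pred I)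
    (F : I -> {ffun 'I_n -> R}) k :
  (\prod_(i <- s | P i) F i) k = \prod_(i <- s | P i) F i k.
Proof.
apply: (big_morph (fun g : {ffun 'I_n -> R} => g k)) => [g h|];
  by rewrite ffunE.
Qed.

Variable J : set R.
Hypothesis idJ : ideal J.
Hypothesis qinv : forall x, exists y, J (x * (1 - x * y)).

Definition idem_mod : set R := [set x | J (x * x - x)].

Let J0 : J 0. Proof. by case: idJ. Qed.
Let JD x y : J x -> J y -> J (x + y). Proof. by case: idJ => _ + _; apply. Qed.
Let JM r x : J x -> J (r * x). Proof. by case: idJ => _ _; apply. Qed.

Lemma idem_mod_ideal x : J x -> idem_mod x.
Proof. by move=> Jx; apply: idealB => //; apply: JM. Qed.

Lemma idem_mod_cong x y : J (x - y) -> idem_mod y -> idem_mod x.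
Proof.
rewrite /idem_mod /= => Jd Jy.
rewrite (_ : _ - _ = (x + y - 1) * (x - y) + (y * y - y)); last by ring.
by apply: JD => //; apply: JM.
Qed.

Lemma idem_mod_1 : idem_mod 1.
Proof. by rewrite /idem_mod /= mulr1 subrr. Qed.

Lemma idem_modM x y : idem_mod x -> idem_mod y -> idem_mod (x * y).
Proof.
rewrite /idem_mod /= => Jx Jy.
rewrite (_ : _ - _ = (y * y) * (x * x - x) + x * (y * y - y)); last by ring.
by apply: JD; apply: JM.
Qed.

Lemma idem_mod_compl x : idem_mod x -> idem_mod (1 - x).
Proof. by rewrite /idem_mod /=; congr J; ring. Qed.

(** Modulo J, the element e is the indicator function of the coordinates at
    which b takes the same value as at i.  It is the Lagrange polynomial
    prod_j (b - b_j) / (b_i - b_j) evaluated at b, where division uses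
    quasi-inverses c_j of b_i - b_j: the j-th factor is
    1 - (b_i - b_j) c_j + (b - b_j) c_j, which is the constant 1 in the residue
    fields where b_i = b_j. *)
Lemma interpolation A (b : {ffun 'I_n -> R}) (i : 'I_n) :
  subalgebra (@diagonal R n) A -> A b ->
  exists e : {ffun 'I_n -> R},
    [/\ A e, forall k, idem_mod (e k), J (e i - 1)
      & forall k, J (e k * (b k - b i))].
Proof.
move=> subA Ab; have /subalgebraP[A1 AB AM AZ] := subA.
have [y hy] := choice qinv.
pose c j := y (b i - b j).
(* f k cuts out the residue fields in which b_k = b_i. *)
pose f k := 1 - (b i - b k) * c k.
pose F j : {ffun 'I_n -> R} :=
  diagonal n (1 - (b i - b j) * c j - b j * c j) * 1 + diagonal n (c j) * b.
have FE j k : F j k = 1 - (b i - b j) * c j + (b k - b j) * c j.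
  by rewrite !ffunE; ring.
have Jf k : J (f k * (b k - b i)).
  rewrite (_ : _ * _ = -1 * ((b i - b k) * (1 - (b i - b k) * c k))).
    by apply: JM; apply: hy.
  by rewrite /f; ring.
have JfF k j : J (f k * (F j k - 1)).
  rewrite FE (_ : _ * _ = c j * (f k * (b k - b i))); first exact: JM.
  by ring.
(* The k-th factor at k is f k, and multiplying by f k turns the others into 1
   modulo J; hence e k is f k modulo J. *)
exists (\prod_j F j); set e := \prod_j F j.
have ef k : J (e k - f k).
  rewrite prod_ffunE (bigD1 k) //= FE subrr mul0r addr0 -/(f k).
  elim/big_rec: _ => [|j x _ Jx]; first by rewrite mulr1 subrr.
  rewrite (_ : _ - _ = F j k * (f k * x - f k) + f k * (F j k - 1)).
    by apply: JD; [apply: JM|].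
  by ring.
split.
- rewrite /e; elim/big_ind: _ => // j _.
  by apply: subalgebraD subA _ _; apply: AZ.
- move=> k; apply: idem_mod_cong (ef k) _; apply: idem_mod_compl.
  rewrite /idem_mod /=.
  rewrite (_ : _ - _ = - c k * ((b i - b k) * (1 - (b i - b k) * c k))).
    by apply: JM; apply: hy.
  by ring.
- have := ef i; rewrite /f subrr mul0r subr0; exact.
- move=> k; rewrite (_ : _ * _ = (b k - b i) * (e k - f k) + f k * (b k - b i)).
    by apply: JD => //; apply: JM.
  by ring.
Qed.

(** The indicators e i of [interpolation] cover all coordinates, so the product
    of the 1 - e i vanishes modulo J.  Multiplying b by these factors one at a
    time changes it, modulo J, by b_i times a tuple of idempotents of A, and
    tuples with entries in J are themselves tuples of idempotents modulo J. *)
Lemma subalgebra_idem_mod A B :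
  subalgebra (@diagonal R n) A -> subalgebra (@diagonal R n) B ->
  (forall x, A x -> (forall i, idem_mod (x i)) -> B x) -> A `<=` B.
Proof.
move=> subA subB TAB b Ab.
have /subalgebraP[A1 AB AM AZ] := subA.
have /subalgebraP[_ _ _ BZ] := subB.
have JAB x : A x -> (forall k, J (x k)) -> B x.
  by move=> Ax Jx; apply: TAB => // k; apply: idem_mod_ideal.
have /choice[e he] := fun i => interpolation i subA Ab.
have Ae i : A (e i) by have [] := he i.
have Te i k : idem_mod (e i k) by have [] := he i.
have peel s g : A g -> (forall k, idem_mod (g k)) ->
    B (g * \prod_(i <- s) (1 - e i) * b) -> B (g * b).
  elim: s g => [|i s IHs] g Ag Tg; first by rewrite big_nil mulr1.
  rewrite big_cons mulrA => /IHs Bs.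
  have Tge k : idem_mod ((g * e i) k) by rewrite ffunE; apply: idem_modM.
  rewrite (_ : g * b = g * (1 - e i) * b + (diagonal n (b i) * (g * e i) +
             (g * e i * b - diagonal n (b i) * (g * e i)))); last by ring.
  have Age : A (g * e i) by apply: AM.
  apply: (subalgebraD subB); last apply: (subalgebraD subB).
  - apply: Bs => [|k]; first by apply: (AM) => //; apply: (AB).
    rewrite !ffunE; apply: idem_modM => //; exact: idem_mod_compl.
  - by apply: BZ; apply: TAB.
  - apply: JAB => [|k]; first by apply: AB; [apply: AM|apply: AZ].
    have [_ _ _ /(_ k) Jk] := he i.
    rewrite !ffunE (_ : _ - _ = g k * (e i k * (b k - b i))); first exact: JM.
    by ring.
rewrite -[b]mul1r; apply: (peel (index_enum 'I_n)) => // [k|].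
  by rewrite ffunE; apply: idem_mod_1.
apply: JAB => [|k].
  do 2?apply: (AM) => //.
  by elim/big_ind: _ => // i _; apply: AB.
have [_ _ Jk _] := he k.
rewrite !ffunE prod_ffunE (bigD1 k) //= !ffunE.
set p := \prod_(_ | _) _.
rewrite (_ : _ * _ = - (p * b k) * (e k k - 1)); first exact: JM.
by ring.
Qed.

(** Idempotents x, y modulo J with (x) + J = (y) + J agree modulo J, since each
    absorbs the other. *)
Lemma finite_idem_mod : FMIR R -> finite_set J -> finite_set idem_mod.
Proof.
move=> finI finJ.
pose g x := [set z | exists r j, J j /\ z = r * x + j].
have idg x : ideal (g x).
  split=> [|_ _ [r [j [Jj ->]]] [r' [j' [Jj' ->]]]|s _ [r [j [Jj ->]]]].
  - by exists 0, 0; rewrite mul0r addr0.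
  - by exists (r + r'), (j + j'); split; [exact: JD|ring].
  - by exists (s * r), (s * j); split; [exact: JM|ring].
have absorb x y : idem_mod y -> g x = g y -> J (x - x * y).
  rewrite /idem_mod /= => Ty e.
  have : g x x by exists 1, 0; rewrite mul1r addr0.
  rewrite e => -[r [j [Jj ->]]].
  rewrite (_ : _ - _ = - r * (y * y - y) + (1 - y) * j); last by ring.
  by apply: JD; apply: JM.
apply: (@finite_fibers _ _ g).
  by apply: sub_finite_set finI => _ [x _ <-]; apply: idg.
move=> I; have [[y [Ty gy]]|none] := pselect (exists y, idem_mod y /\ g y = I).
  apply: sub_finite_set (finite_image (fun j => y + j) finJ) => x [Tx /= gx].
  exists (x - y); last by ring.
  rewrite (_ : x - y = (x - x * y) - (y - y * x)); last by ring.
  by apply: idealB => //; apply: absorb => //; rewrite gx gy.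
rewrite (_ : _ `&` _ = set0) //; apply/seteqP; split=> // x [Tx gx].
by apply: none; exists x.
Qed.

Lemma FIP_diagonal : FMIR R -> finite_set J -> FIP (@diagonal R n).
Proof.
move=> finI finJ.
have finT := finite_idem_mod finI finJ.
have finTn : finite_set [set x : {ffun 'I_n -> R} | forall i, idem_mod (x i)].
  exact: finite_ffun_on.
apply: (@finite_inj_on _ _ (fun A => A `&` [set x | forall i, idem_mod (x i)])).
  by apply: sub_finite_set (finite_subsets finTn) => _ [A _ <-] x [_].
move=> A B subA subB e.
apply/seteqP; split; apply: subalgebra_idem_mod => // x Cx Tx.
  by have [] : (B `&` [set x | forall i, idem_mod (x i)]) x by rewrite -e.
by have [] : (A `&` [set x | forall i, idem_mod (x i)]) x by rewrite e.
Qed.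

End Interpolation.

(** * Nilpotent principal ideals *)

Section LocalRings.
Local Open Scope classical_set_scope.
Local Open Scope ring_scope.

Definition finite_index (R : comNzRingType) (I : set R) : Prop :=
  exists2 F, finite_set F & forall x, exists2 f, F f & I (x - f).

Lemma finite_index_fibers (R : comNzRingType) (I : set R) (U : Type)
    (g : R -> U) :
  finite_set (range g) -> (forall x y, g x = g y -> I (x - y)) ->
  finite_index I.
Proof.
move=> /finite_range_reps[F finF hF] gI; exists F => // x.
by have [f Ff gf] := hF x; exists f => //; apply: gI.
Qed.

Lemma ideal_exp_gen (R : comNzRingType) (t : R) k :
  ideal_exp (principal t) k (t ^+ k).
Proof.
elim: k => [//|k IHk] I [_]; apply; exists t, (t ^+ k); split=> //.
  exact: principal_gen.
by rewrite exprS.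
Qed.

Lemma ideal_exp_principal (R : comNzRingType) (t : R) k :
  ideal_exp (principal t) k `<=` principal (t ^+ k).
Proof.
elim: k => [x _|k IHk]; first by exists x; rewrite // expr0 mulr1.
apply: smallest_sub; first exact: ideal_principal.
move=> _ [_ [y [[r _ <-] /IHk[s _ <-] ->]]].
by exists (r * s) => //; rewrite exprS mulrACA.
Qed.

(** Each (t ^ i) is the sum of (t ^ i+1) and of the multiples of t ^ i by
    representatives of R / (t); descend from (t ^ k) = 0. *)
Lemma finite_of_nilpotent (R : comNzRingType) (t : R) k :
  finite_index (principal t) -> t ^+ k = 0 -> finite_set [set: R].
Proof.
move=> [F finF hF] tk0.
suff H j : finite_set (principal (t ^+ (k - j))).
  have := H k; rewrite subnn expr0; congr finite_set.
  by apply: ideal_1 (principal_gen 1); apply: ideal_principal.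
elim: j => [|j IHj].
  rewrite subn0 tk0; apply: sub_finite_set (finite_set1 0) => _ [r _ <-].
  by rewrite mulr0.
have [lt_jk|le_kj] := ltnP j k; last first.
  move: IHj; rewrite (eqP (le_kj : k - j == 0)%N).
  by rewrite (eqP (leqW le_kj : k - j.+1 == 0)%N).
apply: sub_finite_set
  (finite_image2 (fun f z => f * t ^+ (k - j.+1) + z) finF IHj) => _ [x _ <-].
have [f Ff [r _ rt]] := hF x.
exists f => //; exists (r * t ^+ (k - j)); first by exists r.
by rewrite -(subnSK lt_jk) exprS mulrA rt -mulrDl addrC subrK.
Qed.

(** * Local rings with infinite residue field *)

Section Chain.
Variables (L : comNzRingType) (m : set L).
Hypotheses (finL : FMIR L) (idm : ideal m) (m1 : ~ m 1).
Hypothesis unitm : forall x, ~ m x -> exists y, x * y = 1.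
Hypothesis resm : ~ finite_index m.

(** Two of the ideals (x + l y), with l and k distinct in the residue field,
    coincide; their common value contains (l - k) y, hence y and x.  So x and
    y are both multiples, by 1 - l b and b, of z = x + l y, and one of these
    two multipliers is a unit. *)
Lemma principal_chain (x y : L) : principal y x \/ principal x y.
Proof.
have [l [k [e nm]]] : exists l k,
    principal (x + l * y) = principal (x + k * y) /\ ~ m (l - k).
  apply: contrapT => none; apply: resm.
  apply: (@finite_index_fibers _ _ _ (fun l : L => principal (x + l * y))).
    by apply: sub_finite_set finL => _ [l _ <-]; apply: ideal_principal.
  by move=> l k e; apply: contrapT => nm; apply: none; exists l, k.
have [v uv] := unitm nm; have := principal_gen (x + k * y).
rewrite -e => -[r _ rE].
set z := x + l * y in rE *; pose b := v * (1 - r).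
have yE : y = b * z.
  rewrite /b -mulrA mulrBl mul1r rE /z -[LHS]mul1r -uv; ring.
have xE : x = (1 - l * b) * z.
  by rewrite mulrBl mul1r -mulrA -yE /z addrK.
clearbody z b; have [mb|/unitm[c bc]] := pselect (m b).
  have /unitm[c ac] : ~ m (1 - l * b).
    move=> m1b; apply: m1; rewrite -(subrK (l * b) 1).
    by case: (idm) => _ mD mM; apply: mD => //; apply: mM.
  right; exists (b * c) => //; rewrite [in LHS]xE [RHS]yE.
  transitivity (b * ((1 - l * b) * c) * z); first by ring.
  by rewrite ac mulr1.
left; exists ((1 - l * b) * c) => //; rewrite [in LHS]yE [RHS]xE.
transitivity ((1 - l * b) * (b * c) * z); first by ring.
by rewrite bc mulr1.
Qed.

Lemma local_PIR : principal_ideal_ring L.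
Proof.
move=> I idI; pose C := [set X | exists2 t, I t & X = principal t].
have finC : finite_set C.
  by apply: sub_finite_set finL => _ [t _ ->]; apply: ideal_principal.
have C0 : C (principal 0) by exists 0 => //; case: idI.
have [_ [t It ->] tmax] := finite_maximal finC C0.
exists t; apply/seteqP; split; last exact: principal_sub.
move=> y Iy; have [//|yt] := principal_chain y t.
rewrite -(tmax (principal y)); [exact: principal_gen|by exists y|].
by apply: principal_sub yt; apply: ideal_principal.
Qed.

Lemma local_SPIR : m <> [set 0] -> SPIR L.
Proof.
move=> m0; split; first exact: local_PIR.
have [t mt] := local_PIR idm; exists t; rewrite -mt.
have [k tk0] : exists k, t ^+ k = 0.
  have [k [c e]] := FMIR_power_stable t finL; exists k.
  have /unitm[d ud] : ~ m (1 - c * t).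
    move=> mc; apply: m1; rewrite -(subrK (c * t) 1).
    by case: idm => _ + _; apply => //; rewrite mt; exists c.
  rewrite -[LHS]mulr1 -ud mulrA mulrBr mulr1 {1}e exprS.
  by rewrite (_ : _ - _ = 0) ?mul0r //; ring.
have mprop P : ideal P -> P <> setT -> P `<=` m.
  move=> idP PT x Px; apply: contrapT => /unitm[y xy]; apply: PT.
  by apply: ideal_1 => //; rewrite -xy mulrC; case: idP => _ _; apply.
split=> //.
- split=> // [mT|x y mxy]; first by apply: m1; rewrite mT.
  have [mx|/unitm[z xz]] := pselect (m x); [by left|right].
  rewrite -[y]mul1r -xz mulrAC mulrC; by case: idm => _ _; apply.
- move=> P [idP PT Pp]; apply/seteqP; split; first exact: mprop.
  rewrite mt; apply: principal_sub => //.
  have : P (t ^+ k) by rewrite tk0; case: idP.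
  elim: k {tk0} => [/(ideal_1 idP)//|k IHk]; rewrite exprS => /Pp[//|].
  exact: IHk.
- exists k; apply/seteqP; split.
    by rewrite mt => x /ideal_exp_principal[r _ <-]; rewrite tk0 mulr0.
  by move=> _ ->; rewrite -tk0 mt; apply: ideal_exp_gen.
Qed.

End Chain.

(** * Localization at a maximal ideal *)

Section Localization.
Variables (R L : comNzRingType) (phi : {rmorphism R -> L}) (M : set R).
Hypotheses (finR : FMIR R) (hM : maximal_ideal M).
Hypothesis kerphi : forall x, phi x = 0 <-> exists2 u, ~ M u & u * x = 0.
Hypothesis surj : forall z, exists x, phi x = z.

Lemma FMIR_surj : FMIR L.
Proof.
apply: (@finite_inj_on _ _ (fun I => phi @^-1` I)).
  apply: sub_finite_set finR => _ [I [I0 ID IM] <-].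
  split=> [|x y|r x] /=; first by rewrite rmorph0.
    by rewrite rmorphD; apply: ID.
  by rewrite rmorphM; apply: IM.
move=> I I' _ _ e; apply/seteqP; split=> z; have [x <-] := surj z => Ix.
  by rewrite -[I' _]/((phi @^-1` I') x) -e.
by rewrite -[I _]/((phi @^-1` I) x) e.
Qed.

Let m : set L := phi @` M.

Let mP x : m (phi x) -> M x.
Proof.
have [[M0 MD MM] _ Mp] := maximal_prime hM.
move=> [y My e]; have /kerphi[u nMu u0] : phi (x - y) = 0.
  by rewrite rmorphB e subrr.
have /Mp[//|Md] : M (u * (x - y)) by rewrite u0.
by rewrite -(subrK y x); apply: MD.
Qed.

Lemma local_ring_SPIR :
  ~ finite_index M -> (exists2 x, M x & phi x <> 0) ->
  SPIR L /\ infinite_set [set: L].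
Proof.
move=> infM [x0 Mx0 nz].
have [[M0 MD MM] MT Mp] := maximal_prime hM.
have resm : ~ finite_index m.
  move=> [F finF hF]; apply: infM.
  have [h hh] := choice surj.
  exists (h @` F); first exact: finite_image.
  move=> x; have [f Ff mf] := hF (phi x); exists (h f); first by exists f.
  by apply: mP; rewrite rmorphB hh.
split; last first.
  move=> finL; apply: resm; exists setT => // z; exists z => //.
  by exists 0 => //; rewrite rmorph0 subrr.
apply: (@local_SPIR L m) => //.
- exact: FMIR_surj.
- split=> [|_ _ [x Mx <-] [y My <-]|r _ [x Mx <-]].
  + by exists 0; rewrite // rmorph0.
  + by exists (x + y); rewrite ?rmorphD //; apply: MD.
  + have [s <-] := surj r.
    by exists (s * x); rewrite ?rmorphM //; apply: MM.
- rewrite -(rmorph1 phi) => /mP M1; apply: MT; exact: ideal_1 M1.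
- move=> z; have [x <-] := surj z => nmx.
  have nMx : ~ M x by move=> Mx; apply: nmx; exists x.
  have [k [c e]] := FMIR_power_stable x finR.
  exists (phi c); apply/eqP; rewrite -subr_eq0; apply/eqP.
  rewrite -rmorphM -(rmorph1 phi) -rmorphB; apply/kerphi.
  exists (x ^+ k); last first.
    by rewrite mulrBr mulr1 {2}e exprS; ring.
  elim: k {e} => [|k IHk].
    by rewrite expr0 => M1; apply: MT; exact: ideal_1 M1.
  by rewrite exprS => /Mp[].
- move=> m0; apply: nz; suff: [set 0 : L] (phi x0) by [].
  by rewrite -m0; exists x0.
Qed.

End Localization.

End LocalRings.

(** * An infinite Jacobson radical yields an infinite SPIR *)

Section JacobsonFinite.
Local Open Scope classical_set_scope.
Local Open Scope ring_scope.
Variables (R : comNzRingType).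
Hypothesis finR : FMIR R.

(** With I a maximal finite ideal inside the radical and K minimal above it,
    M is the annihilator of K / I = R / M; x generates K over I, and no
    element outside M kills x, so x stays nonzero in the localization. *)
Lemma infinite_jacobson_section :
  infinite_set (@jacobson R) ->
  exists M : set R, [/\ maximal_ideal M, ~ finite_index M &
    exists2 x, jacobson x & forall u, ~ M u -> u * x <> 0].
Proof.
move=> infJ; have idJ := @jacobson_ideal R.
pose C := [set I : set R | [/\ ideal I, I `<=` @jacobson R & finite_set I]].
have finC : finite_set C by apply: sub_finite_set finR => I [].
have C0 : C [set 0].
  split; [split|by move=> _ ->; case: idJ|exact: finite_set1].
  - by [].
  - by move=> _ _ -> ->; rewrite /= addr0.
  - by move=> r _ ->; rewrite /= mulr0.
have [I [idI IJ finI] Imax] := finite_maximal finC C0.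
pose D := [set K : set R |
  [/\ ideal K, K `<=` @jacobson R, I `<=` K & K <> I]].
have finD : finite_set D by apply: sub_finite_set finR => K [].
have DJ : D (@jacobson R) by split=> // e; apply: infJ; rewrite e.
have [K [idK KJ IK neKI] Kmin] := finite_minimal finD DJ.
have [x [Kx nIx]] : exists x, K x /\ ~ I x.
  apply: contrapT => none; apply: neKI; apply/seteqP; split=> // x Kx.
  by apply: contrapT => nIx; apply: none; exists x.
have [[I0 ID IM] [K0 KD KM]] := (idI, idK).
pose ext (N : set R) := [set z | exists r i, [/\ N r, I i & z = r * x + i]].
(* Minimality of K: N x + I is K as soon as it is not contained in I. *)
have extK (N : set R) r0 : ideal N -> N r0 -> ~ I (r0 * x) -> ext N = K.
  move=> [N0 ND NM] Nr0 nI; apply: Kmin; last first.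
    by move=> _ [r [i [_ Ii ->]]]; apply: KD; [apply: KM|apply: IK].
  split.
  - split=> [|_ _ [r [i [Nr Ii ->]]] [s [j [Ns Ij ->]]]|s _ [r [i [Nr Ii ->]]]].
    + by exists 0, 0; rewrite mul0r addr0.
    + by exists (r + s), (i + j); split; [exact: ND|exact: ID|ring].
    + by exists (s * r), (s * i); split; [exact: NM|exact: IM|ring].
  - move=> _ [r [i [_ Ii ->]]]; apply: KJ; apply: KD; first exact: KM.
    exact: IK.
  - by move=> i Ii; exists 0, i; rewrite mul0r add0r.
  - move=> e; apply: nI; rewrite -e; exists r0, 0.
    by rewrite addr0.
pose M := [set r | I (r * x)].
have hM : maximal_ideal M.
  split.
  - rewrite /M; split=> [|r s|r s] /=; rewrite ?mul0r ?mulrDl //.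
      exact: ID.
    by rewrite -mulrA; apply: IM.
  - move=> MT; apply: nIx; rewrite -[x]mul1r.
    by rewrite -[I _]/(M 1) MT.
  - move=> N idN MN.
    have [[r0 [Nr0 nMr0]]|none] := pselect (exists r0, N r0 /\ ~ M r0).
      right; apply: ideal_1 => //.
      have : ext N x by rewrite (extK _ r0).
      move=> [r [i [Nr Ii xE]]].
      case: (idN) => _ ND _; rewrite -(subrK r 1); apply: ND => //.
      by apply: MN; rewrite /M /= mulrBl mul1r {1}xE addrC addKr.
    left; apply/seteqP; split=> // r Nr.
    by apply: contrapT => nMr; apply: none; exists r.
exists M; split=> //.
- move=> [F finF hF]; apply: neKI; apply: (Imax) => //; split=> //.
  rewrite -(extK setT 1) ?mul1r //.
  apply: sub_finite_set
    (finite_image2 (fun f i => f * x + i) finF finI) => _ [r [i [_ Ii ->]]].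
  have [f Ff Mf] := hF r; exists f => //.
  exists ((r - f) * x + i); [exact: ID|ring].
- exists x => [|u nMu ux]; first exact: KJ.
  by apply: nMu; rewrite /M /= ux.
Qed.

End JacobsonFinite.

(** * The localization map *)

Section LocalizationMap.
Local Open Scope classical_set_scope.
Local Open Scope ring_scope.
Variables (R : comNzRingType) (P : set R) (hP : prime_ideal P).

Definition to_loc (x : R) : localization hP :=
  Localization.mk hP x (Localization.den1 hP).

Let denE (u : Localization.den P) : Localization.denv u = sval u.
Proof. by []. Qed.

Lemma to_loc_zmod : zmod_morphism to_loc.
Proof.
move=> x y; rewrite /to_loc -[RHS]/(Localization.add _ (Localization.opp _)).
rewrite Localization.oppE Localization.addE; apply/Localization.mk_eqP.
by exists (Localization.den1 hP); rewrite !denE /=; ring.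
Qed.

Lemma to_loc_monoid : monoid_morphism to_loc.
Proof.
split=> // x y; rewrite /to_loc -[RHS]/(Localization.mul _ _).
rewrite Localization.mulE; apply/Localization.mk_eqP.
by exists (Localization.den1 hP); rewrite !denE /=; ring.
Qed.

HB.instance Definition _ :=
  GRing.isZmodMorphism.Build R (localization hP) to_loc to_loc_zmod.
HB.instance Definition _ :=
  GRing.isMonoidMorphism.Build R (localization hP) to_loc to_loc_monoid.

Lemma to_loc_ker x : to_loc x = 0 <-> exists2 u, ~ P u & u * x = 0.
Proof.
split=> [/Localization.mk_eqP[u]|[u nPu ux]].
  rewrite !denE /= mul0r !mulr1 mulr0 => ux; exists (sval u) => //.
  exact: (@Localization.denP _ _ u).
have Hu : u \notin P by apply/negP; rewrite in_setE.
apply/Localization.mk_eqP; exists (exist _ u Hu).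
by rewrite !denE /= mul0r !mulr1 mulr0.
Qed.

(** If s ^ k = c s ^ (k+1) with s outside P, then 1 / s and c have the same
    image. *)
Lemma to_loc_surj : FMIR R -> forall z, exists x, to_loc x = z.
Proof.
move=> finR z; have [a [s ->]] := Localization.mk_surj z.
have [k [c e]] := FMIR_power_stable (sval s) finR.
have nPk : ~ P (sval s ^+ k).
  have [idP PT Pp] := hP.
  elim: k {e} => [|k IHk]; first by rewrite expr0 => /(ideal_1 idP).
  by rewrite exprS => /Pp[]; [apply: (@Localization.denP _ _ s)|].
have Hk : sval s ^+ k \notin P by apply/negP; rewrite in_setE.
exists (a * c); apply/Localization.mk_eqP; exists (exist _ (sval s ^+ k) Hk).
by rewrite !denE /= mulr1 [in RHS]e exprS; ring.
Qed.

End LocalizationMap.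

(** * Subalgebras of a power and ideals *)

Section Diagonal.
Local Open Scope classical_set_scope.
Local Open Scope ring_scope.
Variables (R : comNzRingType) (n : nat).

Lemma finite_jacobson :
  FMIR R -> ~ SigmaFMIR R -> finite_set (@jacobson R).
Proof.
move=> finR nS; apply: contrapT => /(infinite_jacobson_section finR).
move=> [M [hM infM [x Jx nz]]]; apply: nS; split=> //.
exists M, hM; apply: (@local_ring_SPIR R _ (to_loc (maximal_prime hM)) M) => //.
- exact: to_loc_ker.
- exact: to_loc_surj.
- exists x => [|/to_loc_ker[u nMu ux]]; first exact: Jx.
  exact: nz ux.
Qed.

Lemma FIP_FMIR : (1 < n)%N -> FIP (@diagonal R n) -> FMIR R.
Proof.
move=> n1 fin; pose i0 : 'I_n := Ordinal (ltnW n1); pose i1 := Ordinal n1.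
pose A (I : set R) : set {ffun 'I_n -> R} := [set x | I (x i1 - x i0)].
apply: (@finite_inj_on _ _ A).
  apply: sub_finite_set fin => _ [I idI <-]; have [I0 ID IM] := idI.
  apply/subalgebraP; split=> [|x y Ix Iy|x y Ix Iy|r x Ix].
  - by rewrite /A /= !ffunE subrr.
  - by rewrite /A /= !ffunE opprD addrACA -opprD; apply: idealB.
  - rewrite /A /= !ffunE.
    rewrite (_ : _ - _ = y i1 * (x i1 - x i0) + x i0 * (y i1 - y i0)).
      by apply: ID; apply: IM.
    by ring.
  - by rewrite /A /= !ffunE -mulrBr; apply: IM.
suff H I I' : A I = A I' -> I `<=` I'.
  by move=> I I' _ _ e; apply/seteqP; split; apply: H.
move=> e a Ia.
pose x : {ffun 'I_n -> R} := [ffun i => if i == i1 then a else 0].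
have xE : x i1 - x i0 = a by rewrite !ffunE eqxx subr0.
have : A I x by rewrite /A /= xE.
by rewrite e /A /= xE.
Qed.

Lemma FIP_square : FMIR R -> FIP (@diagonal R 2).
Proof.
move=> fin.
pose d a : {ffun 'I_2 -> R} := [ffun i => if i == ord0 then a else 0].
apply: (@finite_inj_on _ _ (fun A => [set a | A (d a)])).
  apply: sub_finite_set fin => _ [A subA <-].
  have /subalgebraP[A1 AB AM AZ] := subA; split=> [|x y Ax Ay|r x Ax] /=.
  - rewrite (_ : d 0 = 1 - 1); first exact: AB.
    by apply/ffunP=> i; rewrite !ffunE subrr if_same.
  - rewrite (_ : d _ = d x + d y); first exact: subalgebraD subA _ _.
    by apply/ffunP=> i; rewrite !ffunE; case: ifP; rewrite // addr0.
  - rewrite (_ : d _ = diagonal 2 r * d x); first exact: AZ.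
    by apply/ffunP=> i; rewrite !ffunE; case: ifP; rewrite // mulr0.
suff H A B : subalgebra (@diagonal R 2) A -> subalgebra (@diagonal R 2) B ->
    [set a | A (d a)] = [set a | B (d a)] -> A `<=` B.
  by move=> A B sA sB e; apply/seteqP; split; apply: H.
move=> subA subB e x Ax; have /subalgebraP[A1 AB AM AZ] := subA.
have /subalgebraP[B1 BB BM BZ] := subB.
have dE : x - diagonal 2 (x ord_max) * 1 = d (x ord0 - x ord_max).
  apply/ffunP=> i; rewrite !ffunE mulr1; case: eqP => [->//|/eqP ni].
  suff -> : i = ord_max by rewrite subrr.
  by apply/val_inj; case: i ni => [[|[|]]].
have : [set a | A (d a)] (x ord0 - x ord_max).
  by rewrite /= -dE; apply: AB => //; apply: AZ.
rewrite e /= -dE => Bx; rewrite -(subrK (diagonal 2 (x ord_max) * 1) x).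
by apply: subalgebraD subB Bx _; apply: BZ.
Qed.

(** The residue field of L is finite because it indexes a family of subalgebras
    of R^n; these are closed under products because s * s = 0. *)
Lemma FIP_finite_SPIR (L : comNzRingType) (phi : {rmorphism R -> L}) :
  (forall z, exists x, phi x = z) -> (2 < n)%N -> FIP (@diagonal R n) ->
  SPIR L -> finite_set [set: L].
Proof.
move=> surj n2 fin [_ [t [[idt tT tp] _ t0 [k nilt]]]].
have finL : FMIR L.
  by apply: FMIR_surj (FIP_FMIR (ltnW n2) fin) surj.
have tk0 : t ^+ k = 0.
  by have := ideal_exp_gen t k; rewrite nilt.
have [j [tj tSj]] : exists j, t ^+ j.+1 <> 0 /\ t ^+ j.+2 = 0.
  have ex0 : exists k, t ^+ k == 0 by exists k; rewrite tk0.
  have [l /eqP tl lmin] := ex_minnP ex0.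
  case: l tl lmin => [|[|l]] tl lmin.
  - by have := oner_neq0 L; rewrite -(expr0 t) tl eqxx.
  - case: t0; apply/seteqP; split=> [_ [r _ <-]|_ ->]; last by case: idt.
    by rewrite /= -[t]expr1 tl mulr0.
  - exists l; split=> // /eqP/lmin; by rewrite ltnn.
set s := t ^+ j.+1 in tj.
have ts : t * s = 0 by rewrite /s -exprS.
have ss : s * s = 0 by rewrite /s {1}exprSr -mulrA ts mulr0.
(* An element outside the prime (t) is invertible modulo (t), and t kills s. *)
have annt x : x * s = 0 -> principal t x.
  move=> xs; have [l [c e]] := FMIR_power_stable x finL.
  have : principal t (x ^+ l * (1 - c * x)).
    rewrite (_ : _ * _ = x ^+ l - c * x ^+ l.+1); last by rewrite exprS; ring.
    by rewrite -e subrr; case: idt.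
  case/tp => [|[d _ dt]].
    by elim: l {e} => [/(ideal_1 idt)//|l IHl]; rewrite exprS => /tp[].
  case: tj; have := mulr0 d; rewrite -ts mulrA dt.
  by rewrite mulrBl mul1r -mulrA xs mulr0 subr0.
pose i0 : 'I_n := Ordinal (ltnW (ltnW n2)); pose i1 : 'I_n := Ordinal (ltnW n2).
pose i2 : 'I_n := Ordinal n2.
pose A (l : L) : set {ffun 'I_n -> R} := [set x | exists c,
  phi (x i1) = phi (x i0) + c * s /\ phi (x i2) = phi (x i0) + c * (l * s)].
apply: (@finite_of_nilpotent L t k) => //.
apply: (@finite_index_fibers _ _ _ A).
  apply: sub_finite_set fin => _ [l _ <-]; apply/subalgebraP.
  split=> [|x y [c [x1 x2]] [d [y1 y2]]|x y [c [x1 x2]] [d [y1 y2]]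
          |r x [c [x1 x2]]].
  - by exists 0; rewrite !ffunE !mul0r addr0.
  - by exists (c - d); rewrite !ffunE !rmorphB x1 x2 y1 y2; split; ring.
  - exists (c * phi (y i0) + d * phi (x i0)).
    rewrite !ffunE !rmorphM x1 x2 y1 y2; split.
      by rewrite -[LHS]subr0 -(mulr0 (c * d)) -ss; ring.
    by rewrite -[LHS]subr0 -(mulr0 (c * d * l * l)) -ss; ring.
  - by exists (phi r * c); rewrite !ffunE !rmorphM x1 x2; split; ring.
(* A tuple of A_l with 0, s, l s in its first coordinates must, as an element of
   A_l', have s = c s and l s = c (l' s) = l' s. *)
move=> l l' e; apply: annt.
have [[a aE] [b bE]] := (surj s, surj (l * s)).
pose x : {ffun 'I_n -> R} :=
  [ffun i => if i == i1 then a else if i == i2 then b else 0].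
have : A l x by exists 1; rewrite !ffunE /= aE bE rmorph0 !add0r !mul1r.
rewrite e => -[c]; rewrite !ffunE /= aE bE rmorph0 !add0r => -[cs ls].
by rewrite mulrBl ls mulrCA -cs subrr.
Qed.

End Diagonal.

Theorem theorem4p2 (R : comNzRingType) (n : nat) (hn : 1 < n) :
  FIP (@diagonal R n) <-> FMIR R /\ (SigmaFMIR R -> n = 2).
Proof.
split=> [fin|[finR Sn]].
  have finR := FIP_FMIR hn fin; split=> // -[_ [M [hM [spir inf]]]].
  apply/eqP; rewrite eqn_leq hn andbT leqNgt; apply/negP => n2; apply: inf.
  apply: (@FIP_finite_SPIR R n _ (to_loc (maximal_prime hM))) => //.
  exact: to_loc_surj.
have [n2|/eqP n2] := eqVneq n 2; first by rewrite n2; apply: FIP_square.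
apply: (@FIP_diagonal R n (@jacobson R)) => //.
- exact: jacobson_ideal.
- by move=> x; apply: FMIR_quasi_inverse.
- by apply: finite_jacobson => // /Sn.
Qed.
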